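(* Let $(G,\mathcal{O},W)$ be a graph with geometry and for a domain $D$ of $G$ with nonempty boundary let $\{q_n(D)\}_{n\ge0}$ be its heat content asymptotics. Then $\{q_n(D)\}$ determines $\mathrm{spec}^*(D)$: if $D,D'$ are domains of $G$ with nonempty boundary and $q_n(D)=q_n(D')$ for all $n\geq 0$, then $\mathrm{spec}^*(D)=\mathrm{spec}^*(D')$. In addition, $\{q_n(D)\}$ is determined by $\mathrm{pspec}(D)$: if $\mathrm{pspec}(D)=\mathrm{pspec}(D')$ then $q_n(D)=q_n(D')$ for all $n\ge0$. If $D,D'$ are $\alpha$-weight regular (same $\alpha$), the same is true with $\mathrm{pspec}$ replaced by $\mathrm{mspec}$: $\mathrm{mspec}(D)=\mathrm{mspec}(D')$ implies $q_n(D)=q_n(D')$ for all $n\ge0$.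
   Context: A bidirected graph $G=(V,E)$ has edge set $E\subset V\times V$ with $(x,y)\in E$ iff $(y,x)\in E$, no self edges $(x,x)$, and every vertex of finite degree ($V$ may be infinite). An orientation is a subset $\mathcal{O}\subset E$ containing exactly one of $(x,y),(y,x)$ for each edge. A weighting is a pair $W=(W_V,W_E)$ with $W_V:V\to(0,\infty)$ and $W_E:V\times V\to[0,\infty)$ positive exactly on $E$, such that $W_E(x,y)W_V(x)=W_E(y,x)W_V(y)$ for all $x,y\in V$. A graph with geometry is a triple $(G,\mathcal{O},W)$ with $G$ connected bidirected, $\mathcal{O}$ an orientation, $W$ a weighting. The auxiliary weighting is $w_V(x)=\sum_{(x,y)\in E}W_E(x,y)$. For a bidirected subgraph $D=(V',E')$ of $G$, a vertex $x\in V'$ is interior if for all $y\in V$ with $(x,y)\in E$ one has $y\in V'$ and $(x,y)\in E'$. $iD$ is the set of interior vertices, and $\partial D=V'\setminus iD$ is the boundary. A domain of $G$ is a finite connected bidirected subgraph with $iD\neq\emptyset$. $D$ is $\alpha$-weight regular if $w_V(x)=\alpha$ for all $x\in iD$. $C^0(iD)$ is the space of real functions on $iD$, with inner product $\langle f,g\rangle_{iD}=\sum_{x\in iD}f(x)g(x)W_V(x)$. The interior Laplace operator $\Delta_{iD}:C^0(iD)\to C^0(iD)$ is $\Delta_{iD}f(x)=w_V(x)f(x)-\sum_{y\in iD}W_E(x,y)f(y)$; it is self-adjoint. $\mathrm{spec}^*(D)$ is the set (without multiplicity) of eigenvalues $\lambda$ of $\Delta_{iD}$ whose eigenspace contains some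 $\phi$ with $\langle\phi,1\rangle_{iD}\neq0$. $X_n$ is the Markov chain on $V$ with transition probabilities $p(x,y)=W_E(x,y)/w_V(x)$; $E^x$ is expectation for the chain started at $x$. $\eta=\inf\{n\ge0:X_n\notin iD\}$ and $\tau=\sum_{n=0}^{\eta-1}\frac{1}{w_V(X_n)}$. For integers $k\ge1$, $$A_{1,k}(D)=\sum_{x\in iD}E^x[\tau^k]W_V(x),\qquad A_{2,k}(D)=k!\sup_{f\in C^0(iD)\setminus\{0\}}\frac{\langle f,1\rangle_{iD}^2}{|\langle f,\Delta_{iD}^kf\rangle_{iD}|},$$ $\mathrm{mspec}(D)=\{A_{1,k}(D)\}_{k\ge1}$ and $\mathrm{pspec}(D)=\{A_{2,k}(D)\}_{k\ge1}$, as sequences. Heat content: let $H:iD\times[0,\infty)\to\mathbb{R}$ solve $\partial_tH=-\Delta_{iD}H$ on $iD\times(0,\infty)$ with $H(x,0)=1$ on $iD$ (and $H=0$ on $\partial D$). The heat content of $D$ is $Q(t)=\sum_{x\in iD}H(x,t)W_V(x)$, and the heat content asymptotics $q_n$ are the coefficients of its power series $Q(t)=\sum_{n\ge0}q_nt^n$. *)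

(* Defs.v *)
From HB Require Import structures.
From mathcomp Require Export all_boot all_order all_algebra finmap.
From mathcomp Require Export all_classical all_reals all_analysis.

Set Implicit Arguments.
Unset Strict Implicit.
Unset Printing Implicit Defensive.

Import Order.TTheory GRing.Theory Num.Theory.
Import numFieldNormedType.Exports.

Local Open Scope fset_scope.
Local Open Scope classical_set_scope.
Local Open Scope ring_scope.

Definition connected_by (V : choiceType) (A : set V) (E : set (V * V)) : Prop :=
  forall x y, A x -> A y ->
    exists s : seq V, path (fun a b => `[< E (a, b) >]) x s /\ last x s = y.

Record bigraph (V : choiceType) := BiGraph {
  edges : set (V * V);
  edges_sym : forall x y, edges (x, y) <-> edges (y, x);
  edges_irrefl : forall x, ~ edges (x, x);
  edges_finite : forall x, finite_set [set y | edges (x, y)] }.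

Record orientation (V : choiceType) (G : bigraph V) := Orientation {
  oriented : set (V * V);
  oriented_sub : oriented `<=` edges G;
  oriented_one : forall x y, edges G (x, y) ->
    (oriented (x, y) /\ ~ oriented (y, x)) \/
    (oriented (y, x) /\ ~ oriented (x, y)) }.

Record weighting (R : realType) (V : choiceType) (G : bigraph V) := Weighting {
  wV : V -> R;
  wE : V -> V -> R;
  wV_gt0 : forall x, 0 < wV x;
  wE_ge0 : forall x y, 0 <= wE x y;
  wE_gt0 : forall x y, 0 < wE x y <-> edges G (x, y);
  wE_sym : forall x y, wE x y * wV x = wE y x * wV y }.

Record geometry (R : realType) (V : choiceType) := Geometry {
  graph :> bigraph V;
  graph_connected : connected_by setT (edges graph);
  graph_orientation : orientation graph;
  graph_weighting : weighting R graph }.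

Definition W_V (R : realType) (V : choiceType) (G : geometry R V) : V -> R :=
  wV (graph_weighting G).
Definition W_E (R : realType) (V : choiceType) (G : geometry R V) :
  V -> V -> R := wE (graph_weighting G).
Definition w_V (R : realType) (V : choiceType) (G : geometry R V) (x : V) : R :=
  \sum_(y \in [set y | edges G (x, y)]) W_E G x y.

Record finite_subgraph (V : choiceType) (G : bigraph V) := FiniteSubgraph {
  sverts : {fset V};
  sedges : set (V * V);
  sedges_sub : sedges `<=` edges G;
  sedges_verts : forall x y, sedges (x, y) -> x \in sverts /\ y \in sverts;
  sedges_sym : forall x y, sedges (x, y) <-> sedges (y, x) }.

Definition interior_vertices (V : choiceType) (G : bigraph V)
    (D : finite_subgraph G) : {fset V} :=
  [fset x in sverts D |
    `[< forall y, edges G (x, y) -> y \in sverts D /\ sedges D (x, y) >]].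

Definition boundary (V : choiceType) (G : bigraph V)
    (D : finite_subgraph G) : {fset V} :=
  (sverts D `\` interior_vertices D)%fset.

Record domain (V : choiceType) (G : bigraph V) := Domain {
  dgraph :> finite_subgraph G;
  domain_connected : connected_by [set` sverts dgraph] (sedges dgraph);
  domain_interior : interior_vertices dgraph != fset0 }.

Section domain_spectrum.
Variables (R : realType) (V : choiceType) (G : geometry R V) (D : domain G).

Definition weight_regular (alpha : R) : Prop :=
  forall x, x \in interior_vertices D -> w_V G x = alpha.

Definition C0 := {ffun interior_vertices D -> R^o}.

Definition inner (f g : C0) : R :=
  \sum_(x : interior_vertices D) f x * g x * W_V G (val x).

Definition one : C0 := [ffun=> 1].

Definition laplace (f : C0) : C0 :=
  [ffun x => w_V G (val x) * f x
             - \sum_(y : interior_vertices D) W_E G (val x) (val y) * f y].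

Fact laplace_is_linear : linear laplace.
Proof.
move=> a f g; apply/ffunP => x; rewrite !ffunE /=.
under eq_bigr do rewrite !ffunE mulrDr -scalerAr.
by rewrite big_split /= -scaler_sumr mulrDr -scalerAr scalerBr opprD addrACA.
Qed.

HB.instance Definition _ :=
  GRing.isLinear.Build R C0 C0 *:%R laplace laplace_is_linear.

Definition spec_star : set R :=
  [set lambda | passmx.leigenvalue (linfun laplace) lambda /\
     exists phi : C0, phi \in passmx.leigenspace (linfun laplace) lambda /\
                      inner phi one != 0].

Definition A2 (k : nat) : \bar R :=
  (k`!%:R%:E * ereal_sup
     [set (inner f one ^+ 2 / `|inner f (iter k laplace f)|)%:E
     | f in [set f : C0 | f != 0%R]])%E.

(* Sequences indexed by k >= 1, shifted to start at 0; same for mspec. *)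
Definition pspec : nat -> \bar R := fun n => A2 n.+1.

(* Only the values at t >= 0 matter; continuity from the right at 0 is what
   ties the initial condition to the flow on t > 0. *)
Definition heat_solution (H : R -> C0) : Prop :=
  [/\ forall (t : R) x, 0 < t ->
        is_derive t 1 (fun s => H s x : R) (- laplace (H t) x),
      H 0 = one &
      forall x, (H s x : R) @[s --> 0^'+] --> (H 0 x : R)].

(* The solution is unique on t >= 0 and its power series is unique, so the
   choices made by xget affect only heat_flow at t < 0. *)
Definition heat_flow : R -> C0 := xget (fun=> 0) heat_solution.

Definition heat_content (t : R) : R :=
  \sum_(x : interior_vertices D) heat_flow t x * W_V G (val x).

Definition heat_asymptotics : nat -> R :=
  xget (fun=> 0) [set q : nat -> R | forall t : R, 0 <= t ->
    series (fun n => q n * t ^+ n) @ \oo --> heat_content t].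

End domain_spectrum.

Section markov.
Variables (R : realType) (V : choiceType) (G : geometry R V).
Variables (d : measure_display) (Omega : measurableType d).

Definition transition (x y : V) : R := W_E G x y / w_V G x.

(* V is countable because G is connected and locally finite, so measurability
   and laws are tested on single states. The last clause is the conditional
   Markov property multiplied out, which avoids conditioning on null events. *)
Record is_markov_chain (P : V -> probability Omega R) (X : nat -> Omega -> V) :
    Prop := IsMarkovChain {
  chain_measurable : forall n y, measurable (X n @^-1` [set y]);
  chain_init : forall x, P x (X 0%N @^-1` [set x]) = 1%E;
  chain_step : forall x n (s : nat -> V),
    P x [set w | forall m, (m <= n.+1)%N -> X m w = s m] =
    (P x [set w | forall m, (m <= n)%N -> X m w = s m] *
     (transition (s n) (s n.+1))%:E)%E }.

Variables (P : V -> probability Omega R) (X : nat -> Omega -> V).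
Variable D : domain G.

(* exit_step and exit_time may be infinite (on a null set when D has nonempty
   boundary), so expectations are integrals of extended-real functions. *)
Definition exit_step (w : Omega) : \bar R :=
  ereal_inf [set n%:R%:E | n in [set n | X n w \notin interior_vertices D]].

Definition exit_time (w : Omega) : \bar R :=
  (\sum_(0 <= n <oo | n%:R%:E < exit_step w) ((w_V G (X n w))^-1)%:E)%E.

Definition A1 (k : nat) : \bar R :=
  (\sum_(x : interior_vertices D)
     (\int[P (val x)]_w (exit_time w ^+ k)) * (W_V G (val x))%:E)%E.

Definition mspec : nat -> \bar R := fun n => A1 n.+1.

End markov.

(* Main.v *)
Require Import Defs.
From mathcomp Require Import ring lra measurable_realfun.

(** Let [S] be the interior Laplacian, [m_n = <S^n 1, 1>] and [u_k = S^{-k} 1].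
    The heat coefficients are [q_n = (-1)^n / n! m_n], and the star spectrum is
    the set of roots of the minimal polynomial of the vector [1] under [S],
    which depends only on the functional [p |-> <p(S) 1, 1>], that is, on the
    [m_n].

    By Cauchy-Schwarz [A_{2,k} = k! <u_k, 1>].  In the [alpha]-regular case
    [S = alpha (1 - T)] with [T] the killed transition operator, the
    exit time is [eta / alpha], and [P^x(eta > n) = T^n 1 (x)]; the rising
    factorial moments of [eta], which are nonnegative combinations of its power
    moments, are multiples of [(1 - T)^{-k} 1 = alpha^k u_k].  So either
    sequence gives all the negative moments [m_{-k} = <u_k, 1>].

    A polynomial annihilating [1] for both domains imposes one linear
    recurrence on both two-sided sequences [m], so equality of the negative
    moments propagates to the nonnegative ones. *)

Set Implicit Arguments.
Unset Strict Implicit.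
Unset Printing Implicit Defensive.

Import Order.TTheory GRing.Theory Num.Theory.
Import numFieldNormedType.Exports.

Local Open Scope classical_set_scope.
Local Open Scope ring_scope.

(** * Polynomials in the interior Laplacian *)

Section PolynomialAction.
Variables (K : fieldType) (U : vectType K) (S : {linear U -> U}).
Implicit Types (p q : {poly K}) (f : U).

(** This is [p(S) f], written with iterates of the function so that it applies to [laplace] without
    passing through matrices. *)
Definition poly_act p f : U := \sum_(i < size p) p`_i *: iter i S f.

Lemma poly_act_widen n p f : (size p <= n)%N ->
  poly_act p f = \sum_(i < n) p`_i *: iter i S f.
Proof.
move=> pn; rewrite /poly_act (big_ord_widen _ (fun i => p`_i *: iter i S f) pn).
rewrite [RHS](bigID (fun i : 'I_n => (i < size p)%N)) /= [X in _ + X]big1 ?addr0//.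
by move=> i; rewrite -leqNgt => /leq_sizeP -> //; rewrite scale0r.
Qed.

Lemma poly_act0 f : poly_act 0 f = 0.
Proof. by rewrite /poly_act size_poly0 big_ord0. Qed.

Lemma poly_actD p q f : poly_act (p + q) f = poly_act p f + poly_act q f.
Proof.
rewrite (poly_act_widen _ (size_polyD p q)).
rewrite (poly_act_widen _ (leq_maxl (size p) (size q))).
rewrite (poly_act_widen _ (leq_maxr (size p) (size q))) -big_split /=.
by apply: eq_bigr => i _; rewrite coefD scalerDl.
Qed.

Lemma poly_actZ c p f : poly_act (c *: p) f = c *: poly_act p f.
Proof.
rewrite (poly_act_widen _ (size_scale_leq c p)) scaler_sumr.
by apply: eq_bigr => i _; rewrite coefZ scalerA.
Qed.

Lemma poly_actC c f : poly_act c%:P f = c *: f.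
Proof.
by rewrite (poly_act_widen f (size_polyC_leq1 c)) big_ord1 coefC.
Qed.

Lemma poly_actMX p f : poly_act (p * 'X) f = S (poly_act p f).
Proof.
have sp : (size (p * 'X)%R <= (size p).+1)%N.
  have [->|p0] := eqVneq p 0; first by rewrite mul0r size_poly0.
  by rewrite size_mulX.
rewrite (poly_act_widen _ sp) big_ord_recl coefMX scale0r add0r.
rewrite /poly_act linear_sum; apply: eq_bigr => i _.
by rewrite coefMX /= linearZ.
Qed.

Lemma iter_linear i : linear (iter i S).
Proof.
by elim: i => [//|i IH] a f g /=; rewrite IH linearP.
Qed.

Lemma iter_linear0 i : iter i S 0 = 0.
Proof. by elim: i => //= i ->; rewrite linear0. Qed.

Lemma poly_act_iter p i f : poly_act p (iter i S f) = iter i S (poly_act p f).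
Proof.
elim: i => //= i <-; rewrite /poly_act linear_sum; apply: eq_bigr => j _.
by rewrite linearZ -iterSr.
Qed.

Lemma poly_actM p q f : poly_act (p * q) f = poly_act p (poly_act q f).
Proof.
elim/poly_ind: p => [|p c IH]; first by rewrite mul0r !poly_act0.
rewrite mulrDl mulrAC !poly_actD !poly_actMX IH mul_polyC poly_actZ.
by rewrite poly_actC.
Qed.

Lemma poly_act_vec0 p : poly_act p 0 = 0.
Proof. by rewrite /poly_act big1 // => i _; rewrite iter_linear0 scaler0. Qed.

(** The first [\dim U + 1] iterates of [f] are linearly dependent, and a dependence relation is the
    coefficient list of [p]. *)
Lemma poly_act_annihilator f : exists2 p, p != 0 & poly_act p f = 0.
Proof.
pose n := (\dim (fullv : {vspace U})).+1.
pose X : n.-tuple U := [tuple iter (i : nat) S f | i < n].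
have nfX : ~~ free X.
  rewrite /free size_tuple neq_ltn; apply/orP; left.
  by rewrite ltnS; apply: dimvS; exact: subvf.
have [k [sk /existsP [i ki]]] : exists k : 'I_n -> K,
    \sum_(i < n) k i *: X`_i = 0 /\ [exists i, k i != 0].
  apply/not_existsP => H; move/negP: nfX; apply; apply/freeP => k sk i.
  by apply/eqP/negPn/negP => ki; apply: (H k); split=> //; apply/existsP; exists i.
exists (\poly_(i < n) k (inord i)).
  apply/negP => /eqP /(congr1 (fun p : {poly K} => p`_i)).
  by rewrite coef_poly ltn_ord inord_val coef0 => /eqP; apply/negP.
rewrite (poly_act_widen _ (size_poly _ _)) -[RHS]sk; apply: eq_bigr => j _.
rewrite coef_poly ltn_ord inord_val.
by rewrite -tnth_nth tnth_mktuple.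
Qed.

End PolynomialAction.

(** * Symmetry and positivity of the interior Laplacian *)

Section InteriorLaplacian.
Variables (R : realType) (V : choiceType) (G : geometry R V) (D : domain G).
Local Notation iD := (interior_vertices D).
Local Notation C0 := (C0 D).
Local Notation one := (one D).
Implicit Types (f g : C0) (x y : iD).

Lemma W_V_gt0 x : 0 < W_V G (val x). Proof. exact: wV_gt0. Qed.

Lemma W_E_ge0 (x y : V) : 0 <= W_E G x y. Proof. exact: wE_ge0. Qed.

Lemma innerC f g : inner f g = inner g f.
Proof. by apply: eq_bigr => x _; rewrite [f x * g x]mulrC. Qed.

Lemma innerDl f g h : inner (f + g) h = inner f h + inner g h.
Proof.
by rewrite /inner -big_split; apply: eq_bigr => x _; rewrite ffunE !mulrDl.
Qed.

Lemma innerZl a f g : inner (a *: f) g = a * inner f g.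
Proof.
rewrite /inner mulr_sumr; apply: eq_bigr => x _; rewrite ffunE.
by rewrite /GRing.scale /= !mulrA.
Qed.

Lemma innerDr f g h : inner h (f + g) = inner h f + inner h g.
Proof. by rewrite innerC innerDl !(innerC h). Qed.

Lemma innerZr a f g : inner f (a *: g) = a * inner f g.
Proof. by rewrite innerC innerZl innerC. Qed.

Lemma inner0l f : inner 0 f = 0.
Proof. by rewrite -(scale0r (0 : C0)) innerZl mul0r. Qed.

Lemma inner_suml n (F : 'I_n -> C0) g :
  inner (\sum_(i < n) F i) g = \sum_(i < n) inner (F i) g.
Proof.
apply: (big_morph (fun f : C0 => inner f g)); last exact: inner0l.
by move=> f h; exact: innerDl.
Qed.

Lemma inner_ge0 f : 0 <= inner f f.
Proof.
apply: sumr_ge0 => x _; apply: mulr_ge0; last exact/ltW/W_V_gt0.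
by rewrite -expr2 sqr_ge0.
Qed.

Lemma inner_eq0 f : inner f f = 0 -> f = 0.
Proof.
move=> /eqP; rewrite psumr_eq0 => [/allP f0|x _]; last first.
  by apply: mulr_ge0; [rewrite -expr2 sqr_ge0|exact/ltW/W_V_gt0].
apply/ffunP => x; rewrite ffunE; move: (f0 x); rewrite mem_index_enum.
move=> /(_ isT) /=; rewrite mulf_eq0 (gt_eqF (W_V_gt0 x)) orbF.
by rewrite mulf_eq0 orbb => /eqP.
Qed.

Lemma laplaceE f x : laplace f x =
  w_V G (val x) * f x - \sum_(y : iD) W_E G (val x) (val y) * f y.
Proof. by rewrite ffunE. Qed.

(** The diagonal part is visibly symmetric; [wE_sym] makes the off-diagonal kernel [W_E x y * W_V x]
    symmetric. *)
Lemma laplace_sym f g : inner (laplace f) g = inner f (laplace g).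
Proof.
pose B f g := \sum_(x : iD) \sum_(y : iD) W_E G (val x) (val y) * W_V G (val x) * f y * g x.
have E f' g' : inner (laplace f') g' =
    \sum_(x : iD) w_V G (val x) * f' x * g' x * W_V G (val x) - B f' g'.
  rewrite /inner /B -sumrB; apply: eq_bigr => x _; rewrite laplaceE !mulrBl.
  congr (_ - _); rewrite !mulr_suml; apply: eq_bigr => y _; ring.
rewrite E [RHS]innerC E; congr (_ - _).
  by apply: eq_bigr => x _; ring.
rewrite /B exchange_big /=; apply: eq_bigr => x _; apply: eq_bigr => y _.
by rewrite [W_E _ _ _ * _]wE_sym -/(W_E _ _ _) -/(W_V _ _); ring.
Qed.

Lemma iter_laplace_sym k f g :
  inner (iter k (@laplace _ _ _ D) f) g = inner f (iter k (@laplace _ _ _ D) g).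
Proof.
by elim: k g => //= k IH g; rewrite laplace_sym IH -iterS -iterSr.
Qed.

Let nbrs (x : V) := fset_set [set y | edges G (x, y)].

Let mem_nbrs (x y : V) : (y \in nbrs x) = `[< edges G (x, y) >].
Proof.
rewrite in_fset_set; last exact: edges_finite.
by apply/idP/asboolP; rewrite inE.
Qed.

(** The killing rate at [x]: the part of the degree [w_V] that leads out of the interior. *)
Definition killing (x : V) : R :=
  \sum_(y <- fset_set [set y | edges G (x, y)] | y \notin iD) W_E G x y.

Lemma w_V_killing (x : V) :
  w_V G x = \sum_(y : iD) W_E G x (val y) + killing x.
Proof.
rewrite /w_V fsbig_finite; last exact: edges_finite.
rewrite (bigID (mem iD)) /=; congr (_ + _).
rewrite -(big_seq_fsetE _ iD xpredT (W_E G x)) /=.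
(* Interior vertices that are not neighbours of [x] carry zero weight, so the sum over [iD] reduces
   to neighbours. *)
rewrite [RHS](bigID (mem (nbrs x))) /= [X in _ = _ + X]big1 ?addr0; last first.
  move=> y; rewrite mem_nbrs => /asboolPn nxy; apply/esym/eqP.
  by move: (W_E_ge0 x y); rewrite le_eqVlt => /orP[//|/wE_gt0].
rewrite -[LHS]big_filter -[RHS]big_filter; apply: perm_big; apply: uniq_perm.
- exact/filter_uniq/fset_uniq.
- exact/filter_uniq/fset_uniq.
- by move=> y; rewrite !mem_filter andbC.
Qed.

Lemma killing_ge0 (x : V) : 0 <= killing x.
Proof. by apply: sumr_ge0 => y _; exact: W_E_ge0. Qed.

Lemma killing_gt0 (x y : V) : edges G (x, y) -> y \notin iD -> 0 < killing x.
Proof.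
move=> exy yD; have ny : y \in nbrs x by rewrite mem_nbrs; exact/asboolP.
rewrite /killing (big_rem y) //= yD ltr_pwDl //; first exact/wE_gt0.
by apply: sumr_ge0 => z _; exact: W_E_ge0.
Qed.

(* AM-GM applied to each off-diagonal term [f x * f y]. *)
Lemma laplace_psd f : 0 <= inner f (laplace f).
Proof.
pose c x y := W_E G (val x) (val y) * W_V G (val x).
have cC x y : c x y = c y x by exact: wE_sym.
have c0 x y : 0 <= c x y.
  by apply: mulr_ge0; [exact: W_E_ge0|exact/ltW/W_V_gt0].
have E : inner f (laplace f) =
  \sum_x killing (val x) * f x ^+ 2 * W_V G (val x) +
  \sum_x \sum_y c x y * (f x ^+ 2 - f x * f y).
  rewrite /inner -big_split /=; apply: eq_bigr => x _.
  rewrite laplaceE w_V_killing.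
  rewrite (_ : \sum_y c x y * _ =
     (\sum_(y : iD) W_E G (val x) (val y)) * (f x ^+ 2 * W_V G (val x))
     - (f x * (\sum_(y : iD) W_E G (val x) (val y) * f y)) * W_V G (val x)); first by ring.
  rewrite mulr_suml mulr_sumr mulr_suml -sumrB; apply: eq_bigr => y _.
  by rewrite /c; ring.
(* Adding the double sum to its transpose completes the square. *)
have H : 2 * (\sum_x \sum_y c x y * (f x ^+ 2 - f x * f y)) =
    \sum_x \sum_y c x y * (f x - f y) ^+ 2.
  rewrite mulr2n mulrDl mul1r; rewrite {2}exchange_big -big_split /=.
  apply: eq_bigr => x _; rewrite -big_split /=; apply: eq_bigr => y _.
  by rewrite (cC y x); ring.
rewrite E addr_ge0 //.
  apply: sumr_ge0 => x _; apply: mulr_ge0; last exact/ltW/W_V_gt0.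
  by apply: mulr_ge0; [exact: killing_ge0|exact: sqr_ge0].
rewrite -(pmulr_rge0 _ (ltr0n R 2)) H; apply: sumr_ge0 => x _.
by apply: sumr_ge0 => y _; apply: mulr_ge0 => //; exact: sqr_ge0.
Qed.

(** Half of the iterates move to the left by symmetry; what remains at [S^(k/2) f] is a norm or the
    form of [laplace_psd], by the parity of [k]. *)
Lemma iter_laplace_psd k f : 0 <= inner f (iter k (@laplace _ _ _ D) f).
Proof.
rewrite -(odd_double_half k) iterD -addnn iterD.
set g := iter k./2 _ f; rewrite -/g.
have -> : inner f (iter (odd k) (@laplace _ _ _ D) (iter k./2 (@laplace _ _ _ D) g)) =
   inner g (iter (odd k) (@laplace _ _ _ D) g).
  by rewrite -iterD addnC iterD -iter_laplace_sym.
by case: (odd k) => /=; [exact: laplace_psd|exact: inner_ge0].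
Qed.

End InteriorLaplacian.

(** * Negative moments and the star spectrum *)

Section Moments.
Variables (R : realType) (V : choiceType) (G : geometry R V) (D : domain G).
Hypothesis bdD : boundary D != fset0.
Local Notation iD := (interior_vertices D).
Local Notation C0 := (C0 D).
Local Notation one := (one D).
Local Notation S := (@laplace R V G D).
Implicit Types (f g : C0) (x y : iD).

(* A negative minimum spreads along edges of D until it reaches a vertex with
   a neighbour outside the interior, where the killing term is positive. *)
Lemma laplace_max_principle f :
  (forall x, 0 <= laplace f x) -> forall x, 0 <= f x.
Proof.
move=> Sf x0; rewrite leNgt; apply/negP => fx0.
case: (Order.TotalTheory.arg_minP (f : iD -> R) (isT : xpredT x0)) => m _ fm.
have fm0 : f m < 0 by apply: le_lt_trans fx0; exact: fm.
(* At a vertex where the minimum is attained, [S f x] is minus a sum of nonnegative terms, so all of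
   them vanish. *)
have key x : f x = f m -> killing D (val x) = 0 /\
    forall y, 0 < W_E G (val x) (val y) -> f y = f m.
  move=> fx; have := Sf x; rewrite laplaceE (w_V_killing D) fx.
  have -> : (\sum_(y : iD) W_E G (val x) (val y) + killing D (val x)) * f m -
      \sum_(y : iD) W_E G (val x) (val y) * f y =
      - (\sum_(y : iD) W_E G (val x) (val y) * (f y - f m)
         + killing D (val x) * - f m).
    rewrite (eq_bigr _ (fun y _ => mulrBr (W_E G (val x) (val y)) (f y) (f m))).
    by rewrite sumrB -mulr_suml; ring.
  have t0 y : 0 <= W_E G (val x) (val y) * (f y - f m).
    by apply: mulr_ge0; [exact: W_E_ge0|rewrite subr_ge0; exact: fm].
  have s0 : 0 <= \sum_(y : iD) W_E G (val x) (val y) * (f y - f m).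
    by apply: sumr_ge0.
  have k0 : 0 <= killing D (val x) * - f m.
    by apply: mulr_ge0; [exact: killing_ge0|rewrite oppr_ge0 ltW].
  rewrite oppr_ge0 => le0.
  have /eqP : \sum_(y : iD) W_E G (val x) (val y) * (f y - f m) +
    killing D (val x) * - f m == 0 by rewrite eq_le le0 addr_ge0.
  move/eqP; rewrite paddr_eq0 // => /andP[/eqP s00 /eqP k00]; split.
    by move/eqP: k00; rewrite mulf_eq0 oppr_eq0 (lt_eqF fm0) orbF => /eqP.
  move=> y wxy; apply/eqP; rewrite -subr_eq0.
  move/eqP: s00; rewrite psumr_eq0 // => /allP /(_ y).
  by rewrite mem_index_enum mulf_eq0 (gt_eqF wxy) => /(_ isT).
have walk s x : f x = f m ->
    path (fun a b => `[< sedges D (a, b) >]) (val x) s -> last (val x) s \in iD.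
  elim: s x => [|b s IH] x fx /=; first by rewrite (valP x).
  case/andP => /asboolP exb ps.
  have gxb : edges G (val x, b) by exact: sedges_sub exb.
  have [bD|nbD] := boolP (b \in iD); last first.
    by have := killing_gt0 gxb nbD; rewrite (key _ fx).1 ltxx.
  apply: (IH (FSetSub bD)) ps; apply: (key _ fx).2; exact/wE_gt0.
(* Connectedness of [D] gives a walk from the minimum to a boundary vertex, whereas [walk] confines
   it to the interior. *)
have [b] := fset0Pn _ bdD; rewrite inE => /andP[nbD bD].
have mD : val m \in sverts D by have := valP m; rewrite !inE => /andP[].
have [s [ps ls]] := domain_connected mD bD.
by move: nbD; rewrite -ls (walk s m).
Qed.

(** The maximum principle for [f] and for [- f]; the nonempty boundary keeps constants out of the
    kernel. *)
Lemma laplace_eq0 f : laplace f = 0 -> f = 0.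
Proof.
move=> Sf; apply/ffunP => x; rewrite ffunE; apply/eqP; rewrite eq_le.
have h g : laplace g = 0 -> 0 <= g x.
  by move=> Sg; apply: laplace_max_principle => y; rewrite Sg ffunE.
have := h (- f); rewrite linearN /= Sf oppr0 => /(_ erefl); rewrite ffunE oppr_ge0.
by move=> ->; rewrite h.
Qed.

Lemma laplace_inj : injective S.
Proof.
move=> f g e; apply/eqP; rewrite -subr_eq0; apply/eqP/laplace_eq0.
by rewrite linearB /= e subrr.
Qed.

Lemma iter_laplace_inj k : injective (iter k S).
Proof. by elim: k => [//|k IH] f g /laplace_inj /IH. Qed.

(** This is [S^{-k} 1]; the inverse is a genuine one by [laplace_inj]. For [k = 1] it is the mean of
    the exit time [tau]. *)
Definition exit_iter k : C0 := iter k (linfun S)^-1%VF one.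

Lemma laplace_exit_iter k : laplace (exit_iter k.+1) = exit_iter k.
Proof.
rewrite -[laplace _]lfunE lker0_lfunVK //; apply/lker0P => f g.
by rewrite !lfunE; exact: laplace_inj.
Qed.

Lemma iter_laplace_exit_iter i k :
  iter i S (exit_iter (i + k)) = exit_iter k.
Proof. by elim: i => //= i IH; rewrite -[in LHS]iterS iterSr laplace_exit_iter. Qed.

(* Cauchy-Schwarz for the semidefinite form [inner f (iter k S g)], with
   equality at [f = exit_iter k]. *)
Lemma A2E k : A2 D k = (k`!%:R * inner (exit_iter k) one)%:E.
Proof.
rewrite /A2 EFinM; congr (_ * _)%E.
have Su : iter k S (exit_iter k) = one.
  by rewrite -[k in exit_iter k]addn0 iter_laplace_exit_iter.
set u := exit_iter k; have Suu : inner u (iter k S u) = inner u one by rewrite Su.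
have u0 : u != 0.
  apply/eqP => u0; have [x xD] := fset0Pn _ (domain_interior D).
  have /ffunP /(_ (FSetSub xD)) : one = 0 by rewrite -Su -/u u0 iter_linear0.
  by rewrite !ffunE => /eqP; rewrite oner_eq0.
have uu0 : 0 <= inner u one by rewrite -Suu iter_laplace_psd.
apply/eqP; rewrite eq_le; apply/andP; split.
  apply: ge_ereal_sup => _ [f _ <-]; rewrite lee_fin.
  have f0 : 0 <= inner f (iter k S f) by exact: iter_laplace_psd.
  (* A vanishing denominator makes the quotient [0], by the convention on inverses. *)
  rewrite ger0_norm //; move: f0; rewrite le_eqVlt => /predU1P[<-|f0].
    by rewrite invr0 mulr0.
  rewrite ler_pdivrMr //.
  set a := inner f one; set b := inner f (iter k S f); set c := inner u one.
  have fu : inner f (iter k S u) = a by rewrite Su.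
  have uf : inner u (iter k S f) = a by rewrite -iter_laplace_sym Su innerC.
  (* Positivity of the form at [b u - a f] is the discriminant inequality [a ^+ 2 <= b * c]. *)
  have E : inner (b *: u + (- a) *: f) (iter k S (b *: u + (- a) *: f)) =
      b * (b * c - a ^+ 2).
    have -> : iter k S (b *: u + (- a) *: f) = b *: iter k S u + (- a) *: iter k S f.
      by rewrite iter_linear -[in LHS](addr0 (- a *: f)) iter_linear iter_linear0 addr0.
    rewrite !(innerDl, innerDr, innerZl, innerZr) fu uf Suu -/b -/c; ring.
  have := iter_laplace_psd k (b *: u + (- a) *: f).
  by rewrite E pmulr_rge0 // subr_ge0 mulrC.
apply: ereal_sup_ubound; exists u => //; rewrite Suu ger0_norm //.
move: uu0; rewrite le_eqVlt => /predU1P[<-|uu0]; first by rewrite invr0 mulr0.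
by rewrite expr2 mulfK ?gt_eqF.
Qed.

Definition moment n : R := inner (iter n S one) one.

(** Written through the moments alone, so that domains with equal moments share this functional. *)
Definition moment_poly (p : {poly R}) := \sum_(i < size p) p`_i * moment i.

Lemma inner_poly_act p : inner (poly_act S p one) one = moment_poly p.
Proof.
by rewrite /poly_act inner_suml; apply: eq_bigr => i _; rewrite innerZl.
Qed.

(** Symmetry of [S] moves one factor [X] at a time across the inner product. With [q = p], the
    moments detect whether [p(S)] annihilates [one]. *)
Lemma inner_poly_actM p q :
  inner (poly_act S p one) (poly_act S q one) = moment_poly (p * q).
Proof.
elim/poly_ind: p q => [|p c IH] q.
  by rewrite mul0r poly_act0 inner0l -inner_poly_act poly_act0 inner0l.
have -> : moment_poly ((p * 'X + c%:P) * q) = moment_poly (p * (q * 'X)) + c * moment_poly q.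
  rewrite mulrDl -mulrA (mulrC 'X q) -!inner_poly_act poly_actD innerDl.
  by rewrite mul_polyC poly_actZ innerZl.
rewrite -IH poly_actD innerDl !poly_actMX laplace_sym poly_actC innerZl.
by rewrite [in X in _ + X]innerC inner_poly_act.
Qed.

Lemma leigenspaceP lambda f :
  reflect (laplace f = lambda *: f)
    (f \in passmx.leigenspace (linfun S) lambda).
Proof.
rewrite /passmx.leigenspace memv_ker !lfunE /= opp_lfunE scale_lfunE id_lfunE.
by rewrite lfunE subr_eq0; exact: eqP.
Qed.

Lemma poly_act_eigen p lambda f : laplace f = lambda *: f ->
  poly_act S p f = p.[lambda] *: f.
Proof.
move=> Sf; elim/poly_ind: p => [|p c IH].
  by rewrite poly_act0 horner0 scale0r.
rewrite poly_actD poly_actMX poly_actC IH linearZ /= Sf scalerA -scalerDl.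
by rewrite hornerD hornerMX hornerC.
Qed.

Lemma poly_act_sym p f g : inner (poly_act S p f) g = inner f (poly_act S p g).
Proof.
rewrite [RHS]innerC /poly_act !inner_suml; apply: eq_bigr => i _.
by rewrite !innerZl iter_laplace_sym innerC.
Qed.

(* [lambda] is in the star spectrum iff it is a root of the minimal polynomial
   of the vector [one]; the condition says that every annihilator of [one]
   vanishes at [lambda]. *)
Lemma spec_starP lambda : spec_star D lambda <->
  forall p, moment_poly (p * p) = 0 -> p.[lambda] = 0.
Proof.
have annP p : moment_poly (p * p) = 0 -> poly_act S p one = 0.
  by rewrite -inner_poly_actM => /inner_eq0.
split=> [[_ [phi [/leigenspaceP Sphi phi1]]] p /annP p0|H].
  have := poly_act_sym p phi one; rewrite p0 (poly_act_eigen _ Sphi) innerZl.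
  rewrite [inner phi 0]innerC inner0l => /eqP.
  by rewrite mulf_eq0 (negbTE phi1) orbF => /eqP.
have {}H p : poly_act S p one = 0 -> p.[lambda] = 0.
  by move=> p0; apply: H; rewrite -inner_poly_actM p0 inner0l.
have [p p0 pS] := poly_act_annihilator S one.
have [k [q qr pE]] := multiplicity_XsubC p lambda.
rewrite p0 /= in qr; rewrite pE in pS.
have exj : exists j, poly_act S (('X - lambda%:P) ^+ j * q) one == 0.
  by exists k; rewrite mulrC pS.
(* If the least exponent is [0], then [q(S)] kills [one] and [H] contradicts [q.[lambda] != 0]. If
   it is [j + 1], the vector at exponent [j] is nonzero and killed by [S - lambda]. *)
case: (ex_minnP exj) => -[|j] /eqP pj minj.
  by case/negP: qr; rewrite mul1r in pj; rewrite rootE (H _ pj).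
pose v := poly_act S (('X - lambda%:P) ^+ j * q) one.
have v0 : v != 0 by apply/eqP => /eqP /minj; rewrite ltnn.
have Sv : laplace v = lambda *: v.
  have actXsubC A : poly_act S (('X - lambda%:P) * A) one =
      S (poly_act S A one) - lambda *: poly_act S A one.
    rewrite mulrBl mulrC poly_actD poly_actMX mul_polyC -scaleNr poly_actZ.
    by rewrite scaleNr.
  move: pj; rewrite exprS -mulrA actXsubC -/v => /eqP.
  by rewrite subr_eq0 => /eqP.
have vE : v \in passmx.leigenspace (linfun S) lambda by exact/leigenspaceP.
split.
  by apply/eqP => E0; move: vE v0; rewrite E0 memv0 => /eqP ->; rewrite eqxx.
exists v; split => //; apply/eqP => v1.
(* As [v = p(S) 1] is an eigenvector, [<v, v> = p(lambda) <1, v>], so [<v, 1> = 0] would force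
   [v = 0]. *)
have := poly_act_sym (('X - lambda%:P) ^+ j * q) one v.
rewrite (poly_act_eigen _ Sv) -/v innerZr [inner one v]innerC v1 mulr0.
by move/inner_eq0/eqP; rewrite (negbTE v0).
Qed.

End Moments.

(** * What the positive and the negative moments determine *)

Section Determination.
Variables (R : realType) (V : choiceType) (G : geometry R V) (D D' : domain G).
Hypotheses (bdD : boundary D != fset0) (bdD' : boundary D' != fset0).

Lemma moment_spec_star : moment D =1 moment D' -> spec_star D = spec_star D'.
Proof.
move=> mm; apply/seteqP; split=> l /spec_starP H; apply/spec_starP => p.
  by move=> p0; apply: H; rewrite -p0; apply: eq_bigr => i _; rewrite mm.
by move=> p0; apply: H; rewrite -p0; apply: eq_bigr => i _; rewrite mm.
Qed.

(** Since [r(S)] commutes with the injective [S^d], it kills [S^{-d} 1] as well as [1]; the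
    recurrence is this relation shifted by [S^s] and paired with [1]. *)
Lemma iter_laplace_exit_recurrence (E : domain G) (r : {poly R}) s :
  boundary E != fset0 ->
  poly_act (@laplace R V G E) r (one E) = 0 ->
  \sum_(i < size r)
    r`_i * inner (iter (s + i) (@laplace R V G E) (exit_iter E (size r).-1)) (one E) = 0.
Proof.
move=> bdE r1; set d := (size r).-1.
have r0 : poly_act (@laplace R V G E) r (exit_iter E d) = 0.
  apply: (iter_laplace_inj bdE (k := d)); rewrite iter_linear0 -poly_act_iter.
  by rewrite -[d in exit_iter E d]addn0 iter_laplace_exit_iter.
transitivity (inner (iter s (@laplace R V G E)
    (poly_act (@laplace R V G E) r (exit_iter E d))) (one E)); last first.
  by rewrite r0 iter_linear0 inner0l.
rewrite -poly_act_iter /poly_act inner_suml; apply: eq_bigr => i _.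
by rewrite innerZl -iterD addnC.
Qed.

(* With [r] annihilating the constant function for both domains, the sequences
   [<S^i S^{-d} 1, 1>] satisfy one linear recurrence of order [d = deg r];
   their first [d] terms are negative moments and the later ones include all
   the nonnegative moments. *)
Lemma exit_moment_determines :
  (forall k, inner (exit_iter D k.+1) (one D) =
             inner (exit_iter D' k.+1) (one D')) ->
  moment D =1 moment D'.
Proof.
move=> H.
have [p p0 p1] := poly_act_annihilator (@laplace R V G D) (one D).
have [p' p'0 p'1] := poly_act_annihilator (@laplace R V G D') (one D').
have r1 : poly_act (@laplace R V G D) (p' * p) (one D) = 0.
  by rewrite poly_actM p1 poly_act_vec0.
have r1' : poly_act (@laplace R V G D') (p' * p) (one D') = 0.
  by rewrite mulrC poly_actM p'1 poly_act_vec0.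
have r0 : p' * p != 0 by rewrite mulf_neq0.
set r := p' * p in r1 r1' r0; pose d := (size r).-1.
have sr : size r = d.+1 by rewrite prednK // size_poly_gt0.
pose c (E : domain G) i :=
  inner (iter i (@laplace R V G E) (exit_iter E d)) (one E).
(* The leading coefficient of [r] is nonzero, so [d] consecutive terms fix the next one. *)
have rec s :
    \sum_(i < d) r`_i * c D (s + i)%N = \sum_(i < d) r`_i * c D' (s + i)%N ->
    c D (s + d)%N = c D' (s + d)%N.
  have := iter_laplace_exit_recurrence s bdD' r1'.
  have := iter_laplace_exit_recurrence s bdD r1.
  rewrite -/d !sr !big_ord_recr /= -/d -/(c D _) -/(c D' _) => e e' h.
  have ld : r`_d != 0 by rewrite -/(lead_coef r) lead_coef_eq0.
  apply: (mulfI ld); apply: (addrI (\sum_(i < d) r`_i * c D (s + i)%N)).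
  by rewrite [LHS]e {1}h e'.
have cc i : c D i = c D' i.
  (* For [i < d] the term is the moment of index [i - d], which is strictly negative and so covered
     by the hypothesis. *)
  elim/ltn_ind: i => i IH; have [id|di] := ltnP i d.
    have e (E : domain G) : boundary E != fset0 ->
        c E i = inner (exit_iter E (d - i)) (one E).
      move=> bdE; rewrite /c -[in LHS](subnKC (ltnW id)).
      by rewrite (iter_laplace_exit_iter bdE).
    by rewrite !e //; move: id; rewrite -subn_gt0; case: (d - i)%N.
  rewrite -(subnK di); apply/rec; apply: eq_bigr => j _; rewrite IH //.
  by rewrite -[X in (_ < X)%N](subnK di) ltn_add2l.
move=> n; have := cc (n + d)%N; rewrite /c !iterD.
have Su (E : domain G) : boundary E != fset0 ->
    iter d (@laplace R V G E) (exit_iter E d) = one E.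
  by move=> bdE; rewrite -[X in exit_iter E X]addn0 (iter_laplace_exit_iter bdE).
by rewrite !Su.
Qed.

End Determination.

(** * The heat equation *)

Lemma is_derive_bigsum (R : realType) (I : finType) (h : I -> R -> R)
    (dh : I -> R) (t : R) :
  (forall i, is_derive t 1 (h i) (dh i)) ->
  is_derive t 1 (fun s => \sum_i h i s) (\sum_i dh i).
Proof.
move=> H; have -> : (fun s => \sum_i h i s) = \sum_i h i.
  by apply/funext => s; rewrite fct_sumE.
by elim/big_rec2: _ => [|i df f _ fdf]; [exact: is_derive_cst|exact: is_deriveD].
Qed.

Section Heat.
Variables (R : realType) (V : choiceType) (G : geometry R V) (D : domain G).
Local Notation iD := (interior_vertices D).
Local Notation C0 := (C0 D).
Local Notation one := (one D).
Local Notation S := (@laplace R V G D).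
Implicit Types (f g : C0) (x y : iD).

Lemma w_V_ge0 (z : V) : 0 <= w_V G z.
Proof.
rewrite (w_V_killing D) addr_ge0 ?killing_ge0 //.
by apply: sumr_ge0 => y _; exact: W_E_ge0.
Qed.

(** The constant is the sum of the row norms of [S], a crude bound for their maximum. *)
Lemma laplace_bounded : exists2 M : R, 0 <= M &
  forall f B, (forall x, `|f x| <= B) -> forall x, `|S f x| <= M * B.
Proof.
pose N x := w_V G (val x) + \sum_(y : iD) W_E G (val x) (val y).
have N0 x : 0 <= N x.
  by rewrite addr_ge0 ?w_V_ge0 ?sumr_ge0 // => y _; exact: W_E_ge0.
exists (\sum_x N x) => [|f B fB x]; first by apply: sumr_ge0.
have B0 : 0 <= B by apply: le_trans (fB x).
apply: (@le_trans _ _ (N x * B)); last first.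
  apply: ler_wpM2r => //; rewrite (bigD1 x) //= lerDl.
  by apply: sumr_ge0 => y _; exact: N0.
rewrite laplaceE mulrDl; apply: (le_trans (ler_normB _ _)); apply: lerD.
  by rewrite normrM (ger0_norm (w_V_ge0 _)) ler_wpM2l ?w_V_ge0.
rewrite mulr_suml; apply: (le_trans (ler_norm_sum _ _ _)); apply: ler_sum => y _.
by rewrite normrM (ger0_norm (W_E_ge0 _ _ _)) ler_wpM2l ?W_E_ge0.
Qed.

(** Taylor coefficients in [t] of [exp(- t S) f] at the vertex [x]. *)
Definition heat_coef f x n : R := (-1) ^+ n / n`!%:R * iter n S f x.

(** In sup norm [S^n f] is at most [M ^+ n * B], so an exponential series in [M * |t|] dominates. *)
Lemma heat_coef_cvg f x t : cvgn (pseries (heat_coef f x) t).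
Proof.
have [M M0 HM] := laplace_bounded.
pose B := \sum_x `|f x|.
have fB y : `|f y| <= B.
  by rewrite /B (bigD1 y) //= lerDl; apply: sumr_ge0.
have itB n y : `|iter n S f y| <= M ^+ n * B.
  elim: n y => [|n IH] y; first by rewrite mul1r; exact: fB.
  by rewrite exprS -mulrA; exact: HM.
apply: normed_cvg.
apply: (@series_le_cvg _ _ (fun n => B * exp_coeff (M * `|t|) n)).
- by move=> n; exact: normr_ge0.
- move=> n; rewrite mulr_ge0 ?sumr_ge0 // /exp_coeff /=.
  by rewrite divr_ge0 // exprn_ge0 // mulr_ge0.
- move=> n; rewrite /heat_coef /exp_coeff /= !normrM !normfV normrX normrN1.
  rewrite expr1n mul1r normrX normr_nat exprMn.
  rewrite [leRHS](_ : _ = n`!%:R^-1 * (M ^+ n * B) * `|t| ^+ n); last by ring.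
  by rewrite ler_wpM2r ?exprn_ge0 // ler_wpM2l.
- exact/is_cvg_seriesZ/is_cvg_series_exp_coeff.
Qed.

(** Termwise differentiation of the series of [f] gives the series of [- S f], which is the heat
    equation at the level of coefficients. *)
Lemma heat_coef_diffs f x : pseries_diffs (heat_coef f x) = heat_coef (- S f) x.
Proof.
apply/funext => n; rewrite /pseries_diffs /heat_coef factS natrM iterSr.
have -> : iter n S (- S f) = - iter n S (S f).
  by elim: n => //= n ->; rewrite linearN.
rewrite !ffunE exprS; field.
by rewrite addrC natr1 !pnatr_eq0 -lt0n fact_gt0.
Qed.

Definition heat_series f t : C0 := [ffun x => limn (pseries (heat_coef f x) t)].

Lemma heat_seriesP f t x :
  pseries (heat_coef f x) t @ \oo --> (heat_series f t x : R).
Proof. by rewrite ffunE; exact: heat_coef_cvg. Qed.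

Lemma heat_series_laplace f t : heat_series (S f) t = S (heat_series f t).
Proof.
apply/ffunP => x; apply: (@cvg_unique _ _ (pseries (heat_coef (S f) x) t @ \oo)) => //.
  exact: heat_seriesP.
rewrite laplaceE.
have -> : pseries (heat_coef (S f) x) t = (fun n =>
    w_V G (val x) * pseries (heat_coef f x) t n -
    \sum_(y : iD) W_E G (val x) (val y) * pseries (heat_coef f y) t n).
  apply/funext => n; rewrite /pseries /series /= mulr_sumr.
  rewrite (eq_bigr (fun y => \sum_(0 <= i < n)
    W_E G (val x) (val y) * (heat_coef f y i * t ^+ i))); last first.
    by move=> y _; rewrite mulr_sumr.
  rewrite exchange_big -sumrB; apply: eq_bigr => i _ /=.
  rewrite /heat_coef -iterSr iterS laplaceE mulrBr mulrBl.
  congr (_ - _); first by ring.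
  rewrite mulr_sumr mulr_suml.
  by apply: eq_bigr => y _; ring.
apply: cvgB; first by apply: cvgM; [exact: cvg_cst|exact: heat_seriesP].
apply: cvg_big => [|y _]; first exact: add_continuous.
by apply: cvgM; [exact: cvg_cst|exact: heat_seriesP].
Qed.

Lemma heat_seriesN f t : heat_series (- f) t = - heat_series f t.
Proof.
apply/ffunP => x; apply: (@cvg_unique _ _ (pseries (heat_coef (- f) x) t @ \oo)) => //.
  exact: heat_seriesP.
rewrite ffunE.
have -> : pseries (heat_coef (- f) x) t =
    (fun n => - pseries (heat_coef f x) t n).
  apply/funext => n; rewrite /pseries /series /= -sumrN; apply: eq_bigr => i _.
  rewrite /heat_coef; have -> : iter i S (- f) = - iter i S f.
    by elim: i => //= i ->; rewrite linearN.
  by rewrite ffunE mulrN mulNr.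
by apply: cvgN; exact: heat_seriesP.
Qed.

Lemma heat_series_derive f (t : R) x :
  is_derive t 1 (fun s => heat_series f s x : R) (- S (heat_series f t) x).
Proof.
have -> : (fun s => heat_series f s x : R) = (fun s => limn (pseries (heat_coef f x) s)).
  by apply/funext => s; rewrite ffunE.
have -> : - S (heat_series f t) x = limn (pseries (pseries_diffs (heat_coef f x)) t).
  have /ffunP /(_ x) := heat_seriesN (S f) t.
  by rewrite heat_series_laplace heat_coef_diffs !ffunE => ->.
(* The series converge everywhere, so any radius beyond [|t|] serves. *)
apply: (@pseries_snd_diffs _ _ (`|t| + 1)); rewrite ?heat_coef_diffs;
  try exact: heat_coef_cvg.
by rewrite [ltRHS]ger0_norm ?addr_ge0 // ltrDl.
Qed.

Lemma heat_series_solution : @heat_solution R V G D (heat_series one).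
Proof.
split.
- by move=> t x _; exact: heat_series_derive.
- apply/ffunP => x.
  apply: (@cvg_unique _ _ (pseries (heat_coef one x) 0 @ \oo)) => //.
    exact: heat_seriesP.
  apply: (@cvg_trans _ ((fun=> one x : R) @ \oo)); last exact: cvg_cst.
  apply: near_eq_cvg; near=> n.
  have n0 : (0 < n)%N by near: n; exact: nbhs_infty_gt.
  rewrite /pseries /series /= big_ltn // expr0 big_nat big1.
    by rewrite /heat_coef expr0 fact0 divr1 !mul1r mulr1 addr0.
  by move=> i /andP[i0 _]; rewrite expr0n gtn_eqF // mulr0.
- move=> x; apply: cvg_at_right_filter.
  have [dh _] := heat_series_derive one 0 x.
  exact/differentiable_continuous/derivable1_diffP.
Unshelve. all: by end_near. Qed.

(* The energy [inner u u] of the difference [u] of two solutions decreases. *)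
Lemma heat_solution_unique (H1 H2 : R -> C0) :
  @heat_solution R V G D H1 -> @heat_solution R V G D H2 ->
  forall t : R, 0 <= t -> H1 t = H2 t.
Proof.
move=> [d1 i1 c1] [d2 i2 c2] t; rewrite le_eqVlt => /predU1P[<-|t0].
  by rewrite i1.
pose u s := H1 s - H2 s.
pose E s := inner (u s) (u s).
have du (s : R) x : 0 < s -> is_derive s 1 (fun s => u s x : R) (- S (u s) x).
  move=> s0; rewrite /u.
  have -> : - S (H1 s - H2 s) x = - S (H1 s) x - (- S (H2 s) x).
    by rewrite linearB /= !ffunE opprB opprK addrC.
  have -> : (fun s => (H1 s - H2 s) x : R) = (fun s => H1 s x : R) - (fun s => H2 s x : R).
    by apply/funext => r; rewrite !ffunE.
  by apply: is_deriveB; [exact: d1|exact: d2].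
have dE (s : R) : 0 < s -> is_derive s 1 E (- (2 * inner (u s) (S (u s)))).
  move=> s0.
  have -> : - (2 * inner (u s) (S (u s))) =
      \sum_x (2 * (u s x * - S (u s) x)) * W_V G (val x).
    rewrite /inner mulr_sumr -sumrN; apply: eq_bigr => x _.
    by move: (laplace _ x) => z; ring.
  apply: is_derive_bigsum => x; have dx := du s x s0.
  have := is_deriveM (is_deriveM dx dx) (is_derive_cst (W_V G (val x) : R) s 1).
  move=> /is_derive_eq; apply.
  rewrite scaler0 add0r /GRing.scale /=.
  by move: (laplace _ x) => z; ring.
have Et : E t <= E 0.
  apply: (@ler0_derive1_le_cc _ E 0 t); rewrite ?in_itv /= ?lexx ?ltW //.
  - by move=> s; rewrite in_itv /= => /andP[s0 _]; have [] := dE s s0.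
  - move=> s; rewrite in_itv /= => /andP[s0 _]; have [_ dEs] := dE s s0.
    by rewrite derive1E dEs oppr_le0 mulr_ge0 // laplace_psd.
  - have cE (s : R) : 0 < s -> {for s, continuous E}.
      move=> s0; have [dEs _] := dE s s0.
      exact/differentiable_continuous/derivable1_diffP.
    apply/(continuous_within_itvP _ t0); split.
    + by move=> s; rewrite in_itv /= => /andP[s0 _]; exact: cE.
    (* At [0] only continuity from the right is available; it comes from the last clause of
       [heat_solution]. *)
    + apply: cvg_big => [|x _]; first exact: add_continuous.
      have cu : (u s x : R) @[s --> 0^'+] --> (u 0 x : R).
        rewrite /u; have -> : (fun s => (H1 s - H2 s) x : R) =
            (fun s => (H1 s x : R) - H2 s x).
          by apply/funext => r; rewrite !ffunE.
        by rewrite !ffunE; apply: cvgB; [exact: c1|exact: c2].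
      by apply: cvgM; [exact: cvgM|exact: cvg_cst].
    + by apply: cvg_at_left_filter; exact: cE.
have u0 : u 0 = 0 by rewrite /u i1 i2 subrr.
apply/eqP; rewrite -subr_eq0 -/(u t); apply/eqP/inner_eq0/eqP.
by rewrite eq_le inner_ge0 andbT -/(E t) (le_trans Et) // /E u0 inner0l.
Qed.

Lemma heat_flowE (t : R) : 0 <= t -> heat_flow D t = heat_series one t.
Proof.
apply: heat_solution_unique; last exact: heat_series_solution.
by apply: xgetPex; exists (heat_series one); exact: heat_series_solution.
Qed.

Lemma heat_content_series (t : R) : 0 <= t ->
  series (fun n => ((-1) ^+ n / n`!%:R * moment D n) * t ^+ n) @ \oo --> heat_content D t.
Proof.
move=> t0; rewrite /heat_content heat_flowE //.
have -> : series (fun n => ((-1) ^+ n / n`!%:R * moment D n) * t ^+ n) = (fun n =>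
    \sum_(x : iD) pseries (heat_coef one x) t n * W_V G (val x)).
  apply/funext => n; rewrite /pseries /series /=.
  rewrite (eq_bigr (fun x => \sum_(0 <= i < n)
    (heat_coef one x i * t ^+ i) * W_V G (val x))); last first.
    by move=> y _; rewrite mulr_suml.
  rewrite exchange_big; apply: eq_bigr => i _ /=.
  rewrite /moment /inner mulr_sumr mulr_suml; apply: eq_bigr => x _.
  by rewrite /heat_coef !ffunE; ring.
apply: cvg_big => [|x _]; first exact: add_continuous.
by apply: cvgM; [exact: heat_seriesP|exact: cvg_cst].
Qed.

End Heat.

(** * Uniqueness of power series on the half-line *)

(** The differences [c n] are bounded because the series converges at [t = 1]. If those below [k]
    vanish, the tail beyond [c k * t ^+ k] is at most [2 C t ^+ k.+1] for small [t > 0], so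
    [|c k| <= 2 C t], and [t] tends to [0]. *)
Lemma power_series_unique (R : realType) (a b : nat -> R) (F : R -> R) :
  (forall t, 0 <= t -> series (fun n => a n * t ^+ n) @ \oo --> F t) ->
  (forall t, 0 <= t -> series (fun n => b n * t ^+ n) @ \oo --> F t) ->
  a =1 b.
Proof.
move=> aF bF n; apply/eqP; rewrite -subr_eq0; apply/eqP; move: n.
pose c n := a n - b n.
have c0 t : 0 <= t -> series (fun n => c n * t ^+ n) @ \oo --> (0 : R).
  move=> t0; rewrite -(subrr (F t)).
  have -> : series (fun n => c n * t ^+ n) = (fun N =>
      series (fun n => a n * t ^+ n) N - series (fun n => b n * t ^+ n) N).
    apply/funext => N; rewrite /series /= -sumrB; apply: eq_bigr => i _.
    by rewrite mulrBl.
  by apply: cvgB; [exact: aF|exact: bF].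
have [C [C0 cC]] : exists C, 0 < C /\ forall n, `|c n| <= C.
  have /cvgP /cvg_series_cvg_0 /cvgP /cvg_seq_bounded := c0 1 ler01.
  move=> /pinfty_ex_gt0 [C C0 HC]; exists C; split => // n.
  by have := HC n I; rewrite /= expr1n mulr1.
elim/ltn_ind => k IH; rewrite -/(c k).
(* A geometric tail bound: the factor [2] dominates [1 / (1 - t)] for [t <= 1/2], and the subtracted
   term lets the induction on [N] close. *)
have step t N : 0 < t -> t <= 2^-1 ->
    `|\sum_(0 <= n < N + k.+1) c n * t ^+ n - c k * t ^+ k| <=
    C * (2 * t ^+ k.+1 - 2 * t ^+ (N + k.+1)).
  move=> t0 t2; elim: N => [|N IHN].
    rewrite add0n big_nat_recr //= big_nat big1 => [|i /andP[_ ik]].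
      by rewrite add0r !subrr normr0 mulr0.
    by rewrite /c IH // mul0r.
  rewrite addSn big_nat_recr //= addrAC.
  apply: (le_trans (ler_normD _ _)); apply: (le_trans (lerD IHN (lexx _))).
  rewrite normrM normrX (gtr0_norm t0).
  have tN : 0 < t ^+ (N + k.+1) by rewrite exprn_gt0.
  apply: (@le_trans _ _ (C * (2 * t ^+ k.+1 - 2 * t ^+ (N + k.+1)) + C * t ^+ (N + k.+1))).
    by rewrite lerD2l ler_wpM2r // ltW.
  rewrite -mulrDr ler_pM2l //.
  rewrite [leRHS](_ : _ = 2 * t ^+ k.+1 - 2 * t * t ^+ (N + k.+1)); last first.
    by rewrite (exprS _ (N + k.+1)) mulrA.
  have : (2 * t) * t ^+ (N + k.+1) <= 1 * t ^+ (N + k.+1).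
    by rewrite ler_pM2r // -ler_pdivlMl // mulr1.
  by lra.
have bound t : 0 < t -> t <= 2^-1 -> `|c k| <= 2 * C * t.
  move=> t0 t2.
  have tk : 0 < t ^+ k by rewrite exprn_gt0.
  rewrite -(ler_pM2r tk) -[leRHS]mulrA -exprS -{1}(gtr0_norm tk) -normrM.
  rewrite -normrN -[- _]add0r.
  have cv : `|series (fun n => c n * t ^+ n) N - c k * t ^+ k| @[N --> \oo] -->
      `|0 - c k * t ^+ k|.
    apply: cvg_norm; apply: cvgB; last exact: cvg_cst.
    by apply: c0; exact: ltW.
  rewrite -(cvg_lim _ cv) //; apply: limr_le; first exact: cvgP cv.
  near=> N; have kN : (k.+1 <= N)%N by near: N; exact: nbhs_infty_ge.
  rewrite /series /= -(subnK kN); apply: le_trans (step _ _ t0 t2) _.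
  have : 0 <= C * t ^+ (N - k.+1 + k.+1) by rewrite mulr_ge0 ?exprn_ge0 ?ltW.
  by rewrite mulrBr; lra.
apply/eqP; rewrite -normr_eq0 eq_le normr_ge0 andbT; apply/ler_addgt0Pl => e e0.
rewrite addr0; pose t := Num.min 2^-1 (e / (2 * C)).
have t0 : 0 < t by rewrite lt_min invr_gt0 ltr0n divr_gt0 ?mulr_gt0.
apply: (le_trans (bound t t0 _)); first by rewrite ge_min lexx.
rewrite -ler_pdivlMl ?mulr_gt0 // mulrC; by rewrite ge_min lexx orbT.
Unshelve. all: by end_near. Qed.

Lemma heat_asymptoticsE (R : realType) (V : choiceType) (G : geometry R V)
    (D : domain G) n :
  heat_asymptotics D n = (-1) ^+ n / n`!%:R * moment D n.
Proof.
suff: heat_asymptotics D =1 (fun n => (-1) ^+ n / n`!%:R * moment D n) by apply.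
apply: (@power_series_unique _ _ _ (heat_content D)) => [|t]; last first.
  exact: heat_content_series.
apply: (xgetPex (fun=> 0) (P := [set q : nat -> R | forall t : R, 0 <= t ->
    series (fun n => q n * t ^+ n) @ \oo --> heat_content D t])).
by exists (fun n => (-1) ^+ n / n`!%:R * moment D n); exact: heat_content_series.
Qed.

(** * Resolvent powers as rising factorial sums *)

(** The limit may be [+oo]; its powers are nonzero, so the product [l * l ^+ k] is never of the form
    infinity times zero. *)
Lemma cvge_exp (R : realFieldType) (f : nat -> \bar R) (l : \bar R) k :
  (0 <= l)%E -> f @ \oo --> l -> (f n ^+ k)%E @[n --> \oo] --> (l ^+ k)%E.
Proof.
move=> l0 fl; elim: k => [|k IH]; first exact: cvg_cst.
under eq_fun do rewrite expeS.
rewrite expeS; apply: cvgeM => //; case: l l0 {fl IH} => [r _|_|//].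
  by rewrite -EFin_expe mule_def_fin.
by rewrite mule_def_infty_neq0 // gt_eqF // expe_gt0 // ltry.
Qed.

(** The polynomial [X (X + 1) ... (X + k - 1)]. Its coefficients are nonnegative, so it can be
    evaluated on extended-real moments without cancellation. *)
Definition rising_fact (R : comNzRingType) k : {poly R} :=
  \prod_(i < k) ('X + i%:R%:P).

Section RisingFactorial.
Variable R : realFieldType.
Local Notation rf := (rising_fact R).

Lemma rising_factS k (x : R) : (rf k.+1).[x] = (rf k).[x] * (x + k%:R).
Proof. by rewrite /rising_fact big_ord_recr /= hornerM !hornerE. Qed.

Lemma rising_factSl k (x : R) : (rf k.+1).[x] = x * (rf k).[x + 1].
Proof.
elim: k => [|k IH].
  by rewrite rising_factS /rising_fact big_ord0 !hornerC mul1r mulr1 addr0.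
rewrite rising_factS IH [in RHS]rising_factS -mulrA.
by congr (_ * (_ * _)); rewrite -natr1; ring.
Qed.

(** The discrete counterpart of differentiating a power; it drives the summations by parts below. *)
Lemma rising_fact_diff k (x : R) :
  (rf k.+1).[x + 1] - (rf k.+1).[x] = k.+1%:R * (rf k).[x + 1].
Proof. by rewrite rising_factS rising_factSl -natr1; ring. Qed.

Lemma rising_fact_ge0 k (x : R) : 0 <= x -> 0 <= (rf k).[x].
Proof.
move=> x0; elim: k => [|k IH]; first by rewrite /rising_fact big_ord0 hornerC.
by rewrite rising_factS mulr_ge0 // addr_ge0.
Qed.

Lemma rising_fact_coef_ge0 k i : 0 <= (rf k)`_i.
Proof.
elim: k i => [|k IH] i; first by rewrite /rising_fact big_ord0 coefC; case: eqP.
rewrite /rising_fact big_ord_recr /= -/(rf k) mulrDr coefD coefMX coefMC.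
by rewrite addr_ge0 // ?mulr_ge0 //; case: (i == 0%N).
Qed.

(** Removes the moment of order [0], which [mspec] does not contain. *)
Lemma rising_fact_coef0 k : (rf k.+1)`_0 = 0.
Proof. by rewrite -horner_coef0 rising_factSl mul0r. Qed.

End RisingFactorial.

Section ExitTime.
Variables (R : realType) (V : choiceType) (G : geometry R V) (D : domain G).
Hypothesis bdD : boundary D != fset0.
Variable alpha : R.
Hypothesis wD : weight_regular D alpha.
Local Notation iD := (interior_vertices D).
Local Notation C0 := (C0 D).
Local Notation one := (one D).
Local Notation S := (@laplace R V G D).
Implicit Types (f g : C0) (x y : iD).

Lemma C0_addE f g x : (f + g) x = f x + g x. Proof. by rewrite ffunE. Qed.

Lemma C0_subE f g x : (f - g) x = f x - g x. Proof. by rewrite !ffunE. Qed.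

Lemma C0_scaleE a f x : (a *: f) x = a * f x. Proof. by rewrite ffunE. Qed.

(** If [alpha] were [0], no interior vertex would have killing, and [one] would lie in the kernel of
    the injective [S]. *)
Lemma weight_regular_gt0 : 0 < alpha.
Proof.
have [z zD] := fset0Pn _ (domain_interior D).
rewrite lt_neqAle -(wD zD) (w_V_ge0 D) andbT wD //; apply/eqP => a0.
have k0 x : killing D (val x) = 0.
  have := w_V_killing D (val x); rewrite wD ?(valP x) // -a0 => /esym/eqP.
  rewrite paddr_eq0 ?killing_ge0 //; first by move=> /andP[_ /eqP].
  by apply: sumr_ge0 => y _; exact: W_E_ge0.
have : one = 0.
  apply: (laplace_eq0 bdD); apply/ffunP => x; rewrite laplaceE (w_V_killing D) k0.
  have one1 y : one y = 1 by rewrite ffunE.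
  under [X in _ - X]eq_bigr do rewrite one1 mulr1.
  by rewrite one1 mulr1 addr0 subrr ffunE.
by move/ffunP => /(_ (FSetSub zD)); rewrite !ffunE => /eqP; rewrite oner_eq0.
Qed.

(** The transition operator [T] of the chain killed on leaving the interior. *)
Definition exit_step_op f : C0 :=
  [ffun x => \sum_(y : iD) transition G (val x) (val y) * f y].

Lemma laplace_step f : S f = alpha *: (f - exit_step_op f).
Proof.
apply/ffunP => x; rewrite laplaceE !ffunE /GRing.scale /= mulrBr wD ?(valP x) //.
congr (_ - _); rewrite mulr_sumr; apply: eq_bigr => y _.
rewrite /transition wD ?(valP x) //; field.
by rewrite gt_eqF ?weight_regular_gt0.
Qed.

(** At [x] this is the probability [P^x(eta > n)], by [stay_prob]. *)
Definition survival n : C0 := iter n exit_step_op one.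

Arguments survival : simpl never.

Lemma survival_ge0 n x : 0 <= survival n x.
Proof.
elim: n x => [|n IH] x; first by rewrite ffunE.
rewrite /survival iterS ffunE; apply: sumr_ge0 => y _.
rewrite mulr_ge0 //.
by rewrite divr_ge0 ?W_E_ge0 ?(w_V_ge0 D).
Qed.

Lemma laplace_survival n : S (survival n) = alpha *: (survival n - survival n.+1).
Proof. by rewrite laplace_step. Qed.

Lemma laplace_cvg (a : nat -> C0) (L : C0) :
  (forall x, (a n x : R) @[n --> \oo] --> (L x : R)) ->
  forall x, (S (a n) x : R) @[n --> \oo] --> (S L x : R).
Proof.
move=> aL x; rewrite laplaceE.
under eq_fun do rewrite laplaceE.
apply: cvgB; first by apply: cvgM; [exact: cvg_cst|exact: aL].
apply: cvg_big => [|y _]; first exact: add_continuous.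
by apply: cvgM; [exact: cvg_cst|exact: aL].
Qed.

(** Partial sums of [j!] times the binomial series of [(1 - T)^{-(j + 1)} 1], as [(n + 1) ... (n +
    j) = j! binomial(n + j, j)]. *)
Definition rising_sum j N : C0 :=
  \sum_(n < N) (rising_fact R j).[n.+1%:R] *: survival n.

Lemma rising_sumE j N x :
  rising_sum j N x = series (fun n => (rising_fact R j).[n.+1%:R] * survival n x) N.
Proof.
by rewrite /series /= big_mkord /rising_sum sum_ffunE; apply: eq_bigr => i _; rewrite ffunE.
Qed.

Lemma laplace_rising_sum0 N :
  S (rising_sum 0 N) = alpha *: (one - survival N).
Proof.
elim: N => [|N IH]; first by rewrite /rising_sum big_ord0 linear0 subrr scaler0.
rewrite /rising_sum big_ord_recr /= -/(rising_sum 0 N) linearD /= IH.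
rewrite linearZ /= laplace_survival /rising_fact big_ord0 hornerC scale1r.
by rewrite -scalerDr addrA subrK.
Qed.

(** Summation by parts: [S] turns [survival] into differences, and [rising_fact_diff] lowers the
    degree, leaving one end term at [N]. *)
Lemma laplace_rising_sumS j N :
  S (rising_sum j.+1 N) =
  alpha *: (j.+1%:R *: rising_sum j N - (rising_fact R j.+1).[N%:R] *: survival N).
Proof.
elim: N => [|N IH].
  rewrite /rising_sum !big_ord0 linear0 rising_factSl mul0r scale0r subr0.
  by rewrite !scaler0.
rewrite /rising_sum !big_ord_recr /= -/(rising_sum j N) -/(rising_sum j.+1 N).
rewrite linearD /= IH [S (_ *: _)]linearZ /= laplace_survival scalerA mulrC -scalerA -scalerDr.
congr (_ *: _); have := rising_fact_diff j (N%:R : R); rewrite natr1 => rfE.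
move: (rising_sum j N) (survival N) (survival N.+1) => a b c.
apply/ffunP => x; rewrite !ffunE /GRing.scale /= [in RHS]mulrDr [in RHS]mulrA -rfE; ring.
Qed.

(** Equal to [j! (1 - T)^{-j} 1], which turns out to be the rising factorial moment of [eta] of
    order [j]. *)
Definition exit_rising j : C0 := (j`!%:R * alpha ^+ j) *: exit_iter D j.

Lemma laplace_exit_rising j :
  S (exit_rising j.+1) = alpha *: (j.+1%:R *: exit_rising j).
Proof.
rewrite /exit_rising linearZ /= (laplace_exit_iter bdD) !scalerA factS natrM exprS.
by congr (_ *: _); ring.
Qed.

Lemma exit_rising0 : exit_rising 0 = one.
Proof. by rewrite /exit_rising fact0 mulr1 scale1r. Qed.

(** By the maximum principle it suffices to compare images under [S], where the gap is a positive
    multiple of the previous gap plus a nonnegative end term. *)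
Lemma rising_sum_le j N x :
  j.+1%:R * rising_sum j N x <= exit_rising j.+1 x.
Proof.
have a0 := weight_regular_gt0.
suff : forall x, 0 <= (exit_rising j.+1 - j.+1%:R *: rising_sum j N) x.
  by move=> /(_ x); rewrite C0_subE (C0_scaleE _ (rising_sum j N)) subr_ge0.
elim: j {x} => [|j IH]; apply: (laplace_max_principle bdD) => y.
  rewrite linearB /= [S (_ *: rising_sum _ _)]linearZ /= laplace_rising_sum0.
  rewrite laplace_exit_rising exit_rising0.
  rewrite !scale1r -scalerBr opprB addrC subrK C0_scaleE.
  by rewrite mulr_ge0 ?survival_ge0 ?ltW.
rewrite linearB /= [S (_ *: rising_sum _ _)]linearZ /= laplace_rising_sumS laplace_exit_rising.
rewrite scalerA [alpha * _]mulrC -scalerA -!scalerBr.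
rewrite opprB addrCA C0_scaleE mulr_ge0 // C0_scaleE mulr_ge0 ?(ltW a0) //.
rewrite addrC C0_addE addr_ge0 //.
by rewrite C0_scaleE mulr_ge0 ?survival_ge0 ?rising_fact_ge0.
Qed.

Lemma rising_sum_cvg j x : cvgn (fun N => rising_sum j N x : R).
Proof.
apply: nondecreasing_is_cvgn.
  apply/nondecreasing_seqP => N; rewrite /rising_sum big_ord_recr /= C0_addE lerDl.
  by rewrite C0_scaleE mulr_ge0 ?survival_ge0 ?rising_fact_ge0.
exists (exit_rising j.+1 x) => _ [N _ <-]; apply: le_trans (rising_sum_le j N x).
have s0 : 0 <= rising_sum j N x.
  rewrite rising_sumE; apply: sumr_ge0 => n _.
  by rewrite mulr_ge0 ?survival_ge0 ?rising_fact_ge0.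
by rewrite ler_peMl // ler1n.
Qed.

(** Disposes of the end term of [laplace_rising_sumS]. The terms of a convergent series vanish in
    the limit, and monotonicity of the rising factorial lowers the argument from [N + 1] to [N]. *)
Lemma rising_survival_cvg0 j x :
  ((rising_fact R j).[N%:R] * survival N x : R) @[N --> \oo] --> (0 : R).
Proof.
have c0 : ((rising_fact R j).[N.+1%:R] * survival N x : R) @[N --> \oo] --> (0 : R).
  apply: cvg_series_cvg_0; have := rising_sum_cvg (j := j) (x := x).
  by under eq_fun do rewrite rising_sumE.
apply: squeeze_cvgr (cvg_cst 0) c0; near=> N.
rewrite mulr_ge0 ?survival_ge0 ?rising_fact_ge0 //=.
rewrite ler_wpM2r ?survival_ge0 //; case: j => [|j].
  by rewrite /rising_fact big_ord0 !hornerC.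
rewrite -natr1 -subr_ge0 rising_fact_diff mulr_ge0 // natr1.
exact: rising_fact_ge0.
Unshelve. all: by end_near. Qed.

(* [(1 - T)^{-(j + 1)} = sum_n binomial(n + j, j) T^n] for the substochastic
   transition operator [T], applied to the constant function. *)
Lemma rising_sum_lim j x :
  (j.+1%:R * rising_sum j N x : R) @[N --> \oo] --> (exit_rising j.+1 x : R).
Proof.
pose L j : C0 := [ffun x => limn (fun N => rising_sum j N x : R)].
have cL i y : (rising_sum i N y : R) @[N --> \oo] --> (L i y : R).
  by rewrite ffunE; exact: rising_sum_cvg.
suff LE i : i.+1%:R *: L i = exit_rising i.+1.
  rewrite -LE C0_scaleE; apply: cvgM; [exact: cvg_cst|exact: cL].
(* As [S] is injective and passes to pointwise limits, both sides are compared after applying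
   [S]. *)
elim: i => [|i IH].
  apply: (laplace_inj bdD); rewrite scale1r laplace_exit_rising exit_rising0 scale1r.
  apply/ffunP => y.
  apply: (@cvg_unique _ _ ((S (rising_sum 0 N) y : R) @[N --> \oo])) => //.
    exact: laplace_cvg.
  rewrite C0_scaleE -[one y]subr0.
  have -> : (fun N => S (rising_sum 0 N) y : R) =
      (fun N => alpha * (one y - (rising_fact R 0).[N%:R] * survival N y)).
    apply/funext => N; rewrite /rising_fact big_ord0 hornerC mul1r.
    by rewrite laplace_rising_sum0 C0_scaleE C0_subE.
  apply: cvgM; first exact: cvg_cst.
  by apply: cvgB; [exact: cvg_cst|exact: rising_survival_cvg0].
apply: (laplace_inj bdD); rewrite linearZ /= laplace_exit_rising.
rewrite [RHS]scalerA mulrC -scalerA; congr (_ *: _); apply/ffunP => y.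
apply: (@cvg_unique _ _ ((S (rising_sum i.+1 N) y : R) @[N --> \oo])) => //.
  exact: laplace_cvg.
have -> : (fun N => S (rising_sum i.+1 N) y : R) = (fun N =>
    alpha * (i.+1%:R * rising_sum i N y - (rising_fact R i.+1).[N%:R] * survival N y)).
  by apply/funext => N; rewrite laplace_rising_sumS C0_scaleE C0_subE !C0_scaleE.
rewrite -IH !C0_scaleE -[i.+1%:R * L i y]subr0.
apply: cvgM; first exact: cvg_cst.
apply: cvgB; last exact: rising_survival_cvg0.
by apply: cvgM; [exact: cvg_cst|exact: cL].
Qed.
End ExitTime.

(** * Moments of the exit time *)

Section ExitMoments.
Variables (R : realType) (V : choiceType) (G : geometry R V).
Variables (d : measure_display) (Omega : measurableType d).
Variables (P : V -> probability Omega R) (X : nat -> Omega -> V).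
Hypothesis chainX : is_markov_chain G P X.
Variable D : domain G.
Local Notation iD := (interior_vertices D).
Implicit Types (x y : iD).

Definition stay n : set Omega := [set w | forall m, (m <= n)%N -> X m w \in iD].

Lemma measurable_interior m : measurable [set w | X m w \in iD].
Proof.
have -> : [set w | X m w \in iD] = \bigcup_(y in [set` iD]) X m @^-1` [set y].
  apply/seteqP; split=> w /=; first by move=> h; exists (X m w).
  by move=> [y /= yD ->].
by apply: fin_bigcup_measurable => // y _; exact: chain_measurable chainX _ _.
Qed.

Lemma measurable_stay n : measurable (stay n).
Proof.
have -> : stay n = \bigcap_m [set w | (m <= n)%N -> X m w \in iD].
  by apply/seteqP; split=> w h m; [move=> _ /=; exact: h|exact: h].
apply: bigcapT_measurable => m; have [mn|mn] := leqP m n.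
  rewrite (_ : [set _ | _] = [set w | X m w \in iD]); last first.
    by apply/seteqP; split => w /=; [exact|].
  exact: measurable_interior.
by rewrite (_ : [set _ | _] = setT) //; apply/seteqP; split.
Qed.

(** Interpolates between the cylinder events of [chain_step] ([k = 0]) and the events [stay]
    ([n = 0], up to the starting point). *)
Definition path_stay n (s : nat -> V) k : set Omega :=
  [set w | (forall m, (m <= n)%N -> X m w = s m) /\
           (forall m, (n < m <= n + k)%N -> X m w \in iD)].

Lemma measurable_path_stay n s k : measurable (path_stay n s k).
Proof.
have -> : path_stay n s k =
    (\bigcap_m [set w | (m <= n)%N -> X m w = s m]) `&`
    (\bigcap_m [set w | (n < m <= n + k)%N -> X m w \in iD]).
  apply/seteqP; split=> w /= [h1 h2]; split.
  - by move=> m _; exact: h1.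
  - by move=> m _; exact: h2.
  - by move=> m; exact: h1.
  - by move=> m; exact: h2.
apply: measurableI; apply: bigcapT_measurable => m.
  have [mn|mn] := leqP m n; last first.
    by rewrite (_ : [set _ | _] = setT) //; apply/seteqP; split.
  rewrite (_ : [set _ | _] = X m @^-1` [set s m]); last first.
    by apply/seteqP; split => w /=; [exact|].
  exact: chain_measurable chainX _ _.
have [mn|mn] := boolP (n < m <= n + k)%N; last first.
  by rewrite (_ : [set _ | _] = setT) //; apply/seteqP; split.
rewrite (_ : [set _ | _] = [set w | X m w \in iD]); last first.
  by apply/seteqP; split => w /=; [exact|].
exact: measurable_interior.
Qed.

(* Induction on [k], splitting on the value of [X n.+1]. *)
Lemma path_stay_prob k n (s : nat -> V) y (z : V) : s n = val y ->
  P z (path_stay n s k) =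
  (P z [set w | forall m, (m <= n)%N -> X m w = s m] * (survival D k y)%:E)%E.
Proof.
elim: k n s y => [|k IH] n s y sn.
  rewrite /survival /= ffunE mule1; congr (P z _).
  apply/seteqP; split => w /= => [[]//|h]; split => // m.
  by rewrite addn0 => /andP[nm mn]; move: (leq_trans nm mn); rewrite ltnn.
pose sy (v : V) m := if (m <= n)%N then s m else v.
have -> : path_stay n s k.+1 =
    \big[setU/set0]_(v <- iD) path_stay n.+1 (sy v) k.
  apply/seteqP; split=> w.
    move=> [h1 h2]; have XD : X n.+1 w \in iD.
      by apply: h2; rewrite ltnSn /= -addSnnS leq_addr.
    rewrite (big_rem _ XD) /=; left; split => m; rewrite /sy.
      case: (leqP m n) => [mn _|nm mn]; [exact: h1|].
      by congr (X _ w); apply/eqP; rewrite eqn_leq mn.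
    by move=> /andP[nm mk]; apply: h2; rewrite (ltnW nm) -addSnnS.
  rewrite -bigcup_seq => -[v /= vD [h1 h2]]; split => m.
    by move=> mn; rewrite h1 /sy ?mn // leqW.
  move=> /andP[nm mk]; have [mn|mn] := leqP m n.+1.
    have -> : m = n.+1 by apply/eqP; rewrite eqn_leq mn.
    by rewrite h1 // /sy ltnn.
  by apply: h2; rewrite mn addSnnS.
rewrite measure_fbigsetU; last 2 first.
- by move=> v _; exact: measurable_path_stay.
- apply/trivIsetP => u v _ _ uv; apply/seteqP; split => // w [[hu _] [hv _]].
  case/eqP: uv; have := hu n.+1 (leqnn _); rewrite hv //.
  by rewrite /sy ltnn.
rewrite (big_seq_fsetE _ iD xpredT) /=.
transitivity (\sum_(v : iD) P z [set w | forall m, (m <= n)%N -> X m w = s m] *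
    (transition G (val y) (val v) * survival D k v)%:E)%E.
  apply: eq_bigr => v _; rewrite (IH _ _ v); last by rewrite /sy ltnn.
  rewrite EFinM muleA; congr (_ * _)%E.
  rewrite (chain_step chainX) /sy leqnn ltnn sn; congr (P z _ * _)%E.
  by apply/seteqP; split => w /= h m mn; have := h m mn; rewrite mn.
rewrite -ge0_sume_distrr; last first.
  by move=> v _; rewrite lee_fin mulr_ge0 ?survival_ge0 ?divr_ge0 ?W_E_ge0 ?(w_V_ge0 D).
by rewrite sumEFin ffunE.
Qed.

(** The chain starts at [x] almost surely, so [stay n] may be cut down to a [path_stay] event
    prescribed at time [0] only. *)
Lemma stay_prob n x : P (val x) (stay n) = (survival D n x)%:E.
Proof.
have mS := measurable_stay n; have mX := chain_measurable chainX 0 (val x).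
have PD : P (val x) (stay n `\` X 0%N @^-1` [set val x]) = 0%E.
  apply/eqP; rewrite eq_le measure_ge0 andbT.
  have <- : P (val x) (~` (X 0%N @^-1` [set val x])) = 0%E.
    by rewrite probability_setC // (chain_init chainX) subee.
  apply: le_measure; rewrite ?inE; [exact: measurableD|exact: measurableC|].
  by move=> w [].
rewrite [LHS](etrans (measureDI (P (val x)) mS mX)
  (etrans (congr1 (fun z => z + _)%E PD) (add0e _))).
have -> : stay n `&` X 0%N @^-1` [set val x] = path_stay 0 (fun=> val x) n.
  apply/seteqP; split => w /= [h1 h2]; split.
  - by move=> m; rewrite leqn0 => /eqP ->.
  - by move=> m /andP[_ mn]; exact: h1.
  - move=> m mn; case: m mn => [|m] mn; first by rewrite h1 // (valP x).
    by apply: h2; rewrite add0n mn.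
  - exact: h1.
rewrite [LHS](@path_stay_prob n 0 (fun=> val x) x (val x) erefl).
rewrite (_ : [set _ | _] = X 0%N @^-1` [set val x]); last first.
  apply/seteqP; split => w /= h; first exact: h.
  by move=> m; rewrite leqn0 => /eqP ->.
by rewrite (chain_init chainX) mul1e.
Qed.

Lemma lt_exit_step n w : (n%:R%:E < exit_step X D w)%E <-> stay n w.
Proof.
split.
  move=> nw m mn; apply/negPn/negP => XD.
  move: nw; apply/negP; rewrite -leNgt; apply: (@le_trans _ _ m%:R%:E).
    by apply: ereal_inf_lbound; exists m.
  by rewrite lee_fin ler_nat.
move=> sw; apply: (@lt_le_trans _ _ n.+1%:R%:E); first by rewrite lte_fin ltr_nat.
apply: le_ereal_inf_tmp => _ [m /= XD <-]; rewrite lee_fin ler_nat ltnNge.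
by apply/negP => mn; move: XD; rewrite sw.
Qed.

Variable alpha : R.
Hypothesis bdD : boundary D != fset0.
Hypothesis wD : weight_regular D alpha.

(* Both sides are limits of [(min N eta / alpha) ^+ k], where [eta] is the exit
   step; in particular both are infinite when the chain never exits. *)
Lemma exit_time_expn k w : (0 < k)%N ->
  (exit_time X D w ^+ k =
   \sum_(0 <= n <oo) (alpha^-1 ^+ k * (n.+1%:R ^+ k - n%:R ^+ k))%:E *
     (\1_(stay n) w)%:E)%E.
Proof.
move=> k0; have a0 := weight_regular_gt0 bdD wD.
(* This counts the times before both [N] and the exit, so it is [min N eta]. *)
pose m N := (\sum_(0 <= n < N) (w \in stay n))%N.
have stayW i j : (i <= j)%N -> w \in stay j -> w \in stay i.
  by rewrite !inE => ij h l li; apply: h; exact: leq_trans ij.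
have mE N : w \in stay N -> m N = N.
  move=> wN; rewrite /m big_nat (eq_bigr (fun=> 1%N)) -?big_nat ?sum_nat_const_nat.
    by rewrite subn0 muln1.
  by move=> i /andP[_ iN]; rewrite (stayW _ _ (ltnW iN)).
have sumk N : (\sum_(0 <= n < N) (alpha^-1 ^+ k * (n.+1%:R ^+ k - n%:R ^+ k))%:E *
     (\1_(stay n) w)%:E = ((m N)%:R / alpha)%:E ^+ k)%E.
  elim: N => [|N IH].
    (* The empty sum equals [0 ^+ k] because [k] is positive. *)
    by rewrite /m !big_nil mul0r -EFin_expe expr0n gtn_eqF.
  rewrite big_nat_recr //= IH -EFin_expe indicE.
  have -> : m N.+1 = (m N + (w \in stay N))%N by rewrite /m big_nat_recr.
  have [wN|wN] := boolP (w \in stay N); last by rewrite mule0 adde0 addn0 EFin_expe.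
  rewrite mule1 mE // addn1 -EFinD -EFin_expe !exprMn; congr EFin; ring.
have et : (fun N => ((m N)%:R / alpha)%:E) @ \oo --> exit_time X D w.
  have -> : (fun N => ((m N)%:R / alpha)%:E) =
      (fun N => \sum_(0 <= n < N | n%:R%:E < exit_step X D w)
        ((w_V G (X n w))^-1)%:E)%E.
    apply/funext => N; rewrite big_mkcond natr_sum mulr_suml -sumEFin.
    apply: eq_bigr => n _; have [wn|wn] := boolP (w \in stay n).
      move: wn; rewrite inE => wn; rewrite (lt_exit_step n w).2 //.
      by rewrite mul1r wD // wn.
    rewrite ifF ?mul0r //; apply/negP => /lt_exit_step h.
    by case/negP: wn; rewrite inE.
  apply: is_cvg_nneseries_cond => n _ _.
  by rewrite lee_fin invr_ge0 (w_V_ge0 D).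
apply/esym/cvg_lim => //.
under eq_fun do rewrite sumk.
apply: cvge_exp => //; apply: nneseries_ge0 => n _ _.
by rewrite lee_fin invr_ge0 (w_V_ge0 D).
Qed.

(** Monotone convergence exchanges sum and integral, and the indicators integrate to survival
    probabilities. *)
Lemma exit_time_moment k x : (0 < k)%N ->
  (\int[P (val x)]_w (exit_time X D w ^+ k) =
   \sum_(0 <= n <oo)
     (alpha^-1 ^+ k * (n.+1%:R ^+ k - n%:R ^+ k) * survival D n x)%:E)%E.
Proof.
move=> k0; have a0 := weight_regular_gt0 bdD wD.
have e0 n : 0 <= alpha^-1 ^+ k * (n.+1%:R ^+ k - n%:R ^+ k).
  rewrite mulr_ge0 ?exprn_ge0 ?invr_ge0 ?(ltW a0) //.
  by rewrite subr_ge0 lerXn2r ?nnegrE // ler_nat.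
under eq_integral do rewrite exit_time_expn //.
rewrite integral_nneseries //; last 2 first.
- move=> n; apply: measurable_funeM; apply/measurable_EFinP.
  exact/measurable_indic/measurable_stay.
- by move=> n w _; rewrite mule_ge0 // lee_fin.
apply: eq_eseriesr => n _; rewrite ge0_integralZl_EFin //.
- rewrite integral_indic //; last exact: measurable_stay.
  by rewrite setIT [X in (_ * X)%E](stay_prob n x) -EFinM.
- by apply/measurable_EFinP; exact/measurable_indic/measurable_stay.
Qed.

(** The powers of [alpha] turn moments of the exit time into moments of [eta]. The differences of
    powers combine through [rising_fact_diff] into the terms of [k.+1%:R * rising_sum], whose limit
    is known. *)
Lemma exit_time_rising_moment k x :
  (\sum_(i < size (rising_fact R k.+1))
     ((rising_fact R k.+1)`_i * alpha ^+ i)%:E *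
     \int[P (val x)]_w (exit_time X D w ^+ i) =
   (exit_rising D alpha k.+1 x)%:E)%E.
Proof.
have a0 := weight_regular_gt0 bdD wD.
pose t i n := ((rising_fact R k.+1)`_i * (n.+1%:R ^+ i - n%:R ^+ i) * survival D n x).
have t0 i n : 0 <= t i n.
  rewrite !mulr_ge0 ?survival_ge0 ?rising_fact_coef_ge0 //.
  by rewrite subr_ge0 lerXn2r ?nnegrE // ler_nat.
transitivity (\sum_(i < size (rising_fact R k.+1)) \sum_(0 <= n <oo) (t i n)%:E)%E.
  apply: eq_bigr => i _; case: (nat_of_ord i) => [|{}i].
    rewrite rising_fact_coef0 mul0r mul0e eseries0 // => n _ _.
    by rewrite /t subrr mulr0 mul0r.
  rewrite exit_time_moment // -nneseriesZl; last first.
    move=> n _; rewrite lee_fin !mulr_ge0 ?survival_ge0 ?exprn_ge0 ?invr_ge0 ?(ltW a0) //.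
    by rewrite subr_ge0 lerXn2r ?nnegrE // ler_nat.
  apply: eq_eseriesr => n _; rewrite -EFinM /t; congr EFin.
  have : alpha ^+ i.+1 * alpha^-1 ^+ i.+1 = 1.
    by rewrite -exprMn divff ?gt_eqF // expr1n.
  move: (alpha ^+ _) (alpha^-1 ^+ _) (_ - _) => u v e uv.
  by rewrite -[RHS]mul1r -uv; ring.
rewrite -nneseries_sum; last by move=> i n _; rewrite lee_fin.
apply/cvg_lim => //.
have -> : (fun N => \sum_(0 <= n < N) \sum_(i < size (rising_fact R k.+1)) (t i n)%:E)%E =
    EFin \o (fun N => k.+1%:R * rising_sum D k N x).
  apply/funext => N /=; rewrite rising_sumE /series /= mulr_sumr -sumEFin.
  apply: eq_bigr => n _; rewrite sumEFin mulrA -[n.+1%:R]natr1 -rising_fact_diff natr1.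
  rewrite /t -mulr_suml; congr (_ * _)%:E.
  rewrite 2!horner_coef -sumrB; apply: eq_bigr => i _; exact: mulrBr.
by apply/fine_cvgP; split; [exact: nearW|exact: (rising_sum_lim bdD wD)].
Qed.

(** Expresses the negative moment of order [k + 1] through [A1]; nonnegativity of all terms
    justifies distributing the extended-real sums. *)
Lemma A1_rising k :
  (\sum_(i < size (rising_fact R k.+1))
     ((rising_fact R k.+1)`_i * alpha ^+ i)%:E * A1 P X D i =
   (k.+1`!%:R * alpha ^+ k.+1 * inner (exit_iter D k.+1) (one D))%:E)%E.
Proof.
have a0 := weight_regular_gt0 bdD wD.
have et0 w : (0 <= exit_time X D w)%E.
  by apply: nneseries_ge0 => n _ _; rewrite lee_fin invr_ge0 (w_V_ge0 D).
have int0 i x : (0 <= \int[P (val x)]_w (exit_time X D w ^+ i))%E.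
  by apply: integral_ge0 => w _; exact: expe_ge0.
transitivity (\sum_(x : iD) (exit_rising D alpha k.+1 x)%:E *
  (W_V G (val x))%:E)%E; last first.
  rewrite -innerZl -/(exit_rising D alpha k.+1) /inner -sumEFin.
  apply: eq_bigr => x _; have -> : one D x = 1 by rewrite ffunE.
  by rewrite mulr1 EFinM.
under [RHS]eq_bigr do rewrite -exit_time_rising_moment.
transitivity (\sum_(i < size (rising_fact R k.+1)) \sum_(x : iD)
    ((rising_fact R k.+1)`_i * alpha ^+ i)%:E *
    ((\int[P (val x)]_w (exit_time X D w ^+ i)) * (W_V G (val x))%:E))%E.
  apply: eq_bigr => i _; rewrite /A1 ge0_sume_distrr // => x _.
  by apply: mule_ge0; [exact: int0|rewrite lee_fin ltW ?W_V_gt0].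
rewrite exchange_big; apply: eq_bigr => x _ /=; rewrite ge0_sume_distrl.
  by apply: eq_bigr => i _; rewrite muleA.
move=> i _; apply: mule_ge0; last exact: int0.
by rewrite lee_fin mulr_ge0 ?rising_fact_coef_ge0 // exprn_ge0 // ltW.
Qed.

End ExitMoments.

Theorem theorem1p3 (R : realType) (V : choiceType) (G : geometry R V)
    (D D' : domain G)
    (hD : boundary D != fset0) (hD' : boundary D' != fset0) :
  [/\ (forall n, heat_asymptotics D n = heat_asymptotics D' n) ->
        spec_star D = spec_star D',
      pspec D = pspec D' ->
        forall n, heat_asymptotics D n = heat_asymptotics D' n &
      forall alpha : R, weight_regular D alpha -> weight_regular D' alpha ->
      forall (d : measure_display) (Omega : measurableType d)
        (P : V -> probability Omega R) (X : nat -> Omega -> V),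
        is_markov_chain G P X ->
        mspec P X D = mspec P X D' ->
        forall n, heat_asymptotics D n = heat_asymptotics D' n].
Proof.
have momE : moment D =1 moment D' ->
    forall n, heat_asymptotics D n = heat_asymptotics D' n.
  by move=> h n; rewrite !heat_asymptoticsE h.
split=> [q|ps|alpha wD wD' d Omega P X chainX ms].
- apply: moment_spec_star => n.
  have c0 : (-1) ^+ n / n`!%:R != 0 :> R.
    by rewrite mulf_neq0 ?signr_eq0 // invr_eq0 pnatr_eq0 -lt0n fact_gt0.
  by apply: (mulfI c0); rewrite -!heat_asymptoticsE.
- apply/momE/exit_moment_determines => // k.
  have /(congr1 (fun f => f k)) := ps; rewrite /pspec !A2E // => -[].
  by move/mulfI; apply; rewrite pnatr_eq0 -lt0n fact_gt0.
- apply/momE/exit_moment_determines => // k.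
  have : (k.+1`!%:R * alpha ^+ k.+1 * inner (exit_iter D k.+1) (one D))%:E =
      (k.+1`!%:R * alpha ^+ k.+1 * inner (exit_iter D' k.+1) (one D'))%:E.
    rewrite -(A1_rising chainX hD wD) -(A1_rising chainX hD' wD').
    (* The term of order [0] lies outside [mspec] but has coefficient zero. *)
    apply: eq_bigr => -[[|i] /= _] _; first by rewrite rising_fact_coef0 mul0r !mul0e.
    by have /(congr1 (fun f => f i)) := ms; rewrite /mspec => ->.
  move=> [] /mulfI; apply; rewrite mulf_neq0 ?pnatr_eq0 -?lt0n ?fact_gt0 //.
  by rewrite expf_neq0 // gt_eqF // (weight_regular_gt0 hD wD).
Qed.
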